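(* Let $\mathbb{K}$ be an arbitrary field, let $U$ and $V$ be finite-dimensional vector spaces over $\mathbb{K}$, and let $\mathcal{S}$ be an affine subspace of $\mathcal{L}(U,V)$. Assume that $\operatorname{codim} \mathcal{S} \leq \dim V-2$. Then, every range-compatible affine map $F : \mathcal{S} \rightarrow V$ is local.
   Context: $\mathcal{L}(U,V)$ is the vector space of all linear maps from $U$ to $V$. Affine subspaces are non-empty; the codimension of an affine subspace $\mathcal{S}$ of $\mathcal{L}(U,V)$ is $\dim \mathcal{L}(U,V)-\dim \mathcal{S}$. For a subset $\mathcal{S}$ of $\mathcal{L}(U,V)$, a map $F : \mathcal{S} \rightarrow V$ is called range-compatible when $F(s) \in \operatorname{Im} s$ for all $s \in \mathcal{S}$; it is called local when there exists $x \in U$ such that $F(s)=s(x)$ for all $s \in \mathcal{S}$. *)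

(* Defs.v *)
From mathcomp Require Import all_boot all_order all_algebra.

Set Implicit Arguments.
Unset Strict Implicit.
Unset Printing Implicit Defensive.

Import GRing.Theory.
Local Open Scope ring_scope.

Section AffineSubspaces.

Variables (K : fieldType) (vT : vectType K).

(* The translate aff_origin + aff_dir, which is non-empty by construction. *)
Record affspace := AffSpace { aff_origin : vT; aff_dir : {vspace vT} }.

Definition mem_affspace (S : affspace) : pred vT :=
  fun v => v - aff_origin S \in aff_dir S.

Canonical affspace_predType := PredType mem_affspace.

Definition aff_dim (S : affspace) : nat := \dim (aff_dir S).

(* The truncated subtraction is exact, since aff_dim S <= \dim {:vT}. *)
Definition aff_codim (S : affspace) : nat := (\dim {:vT} - aff_dim S)%N.

Lemma mem_aff_origin (S : affspace) : aff_origin S \in S.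
Proof. by rewrite unfold_in /= /mem_affspace subrr mem0v. Qed.

(* Affine maps are defined through their linear part rather than through
   combinations a *: s + (1 - a) *: t, which do not suffice over F_2. *)
Definition affine_map (rT : vectType K) (S : affspace)
    (F : {s : vT | s \in S} -> rT) : Prop :=
  exists f : 'Hom(subvs_of (aff_dir S), rT),
    forall s t : {s : vT | s \in S},
      F t - F s = f (vsproj (aff_dir S) (val t - val s)).

(* The argument of vsproj above does lie in aff_dir S. *)
Lemma aff_subr_dir (S : affspace) (s t : {s : vT | s \in S}) :
  val t - val s \in aff_dir S.
Proof.
case: s t => [s Ss] [t St] /=.
by rewrite -(subrKA (aff_origin S)) -(opprB s) rpredB.
Qed.

End AffineSubspaces.

Section RangeCompatible.

Variables (K : fieldType) (U V : vectType K) (pT : predType 'Hom(U, V)).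

Definition range_compatible (S : pT) (F : {s : 'Hom(U, V) | s \in S} -> V) :
    Prop :=
  forall s, F s \in limg (val s).

Definition local_map (S : pT) (F : {s : 'Hom(U, V) | s \in S} -> V) : Prop :=
  exists x : U, forall s, F s = val s x.

End RangeCompatible.

(* Main.v *)
Require Import Defs.
From mathcomp Require Import all_boot all_order all_algebra.
Set Implicit Arguments.
Unset Strict Implicit.
Unset Printing Implicit Defensive.
Import GRing.Theory VectorInternalTheory.
Local Open Scope ring_scope.

(* An affine form on S vanishing wherever the affine map s |-> phi s (phi a
   linear form on V) vanishes, if anywhere, is s |-> phi (s x) for some x.
   Range-compatibility of F thus says: for each phi, either the constant form 1
   or the form phi o F is s |-> phi (s x) for some x. The affine forms on S are
   a quotient of (V^* (x) U) + K, and the set N of the tensors that become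
   constant on S has dimension codim S. If N = 0 the vector x is unique for each
   phi <> 0, and linearity in phi makes it constant. Otherwise, take M <> 0 in N
   and a basis of V^* on which all coordinates of M are nonzero. Restricting phi
   to the i-th coordinate hyperplane decreases dim N, so by induction x = x_i
   works there. If all x_i were distinct, then the k-th basis vector tensored
   with x_i - x_j, for distinct i, j, k, would be in N for all k, making
   dim N >= dim V; hence x_i = x_j for some i <> j, and this vector works on the
   sum of two distinct hyperplanes, that is, everywhere. *)

(** * Two facts on matrices *)

(** Adding one nonzero row of [M] to each of its zero rows is invertible: the matrix [C] doing so
    squares to zero. *)
Lemma exists_unit_rows_neq0 (K : fieldType) n p (M : 'M[K]_(n, p)) :
  M != 0 -> exists2 P, P \in unitmx & forall i, row i (P *m M) != 0.
Proof.
move=> M_neq0.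
have [i0 Mi0] : exists i0, row i0 M != 0.
  apply/existsP; apply: contraNT M_neq0; rewrite negb_exists => /forallP M0.
  apply/eqP/row_matrixP => i; rewrite row0; apply/eqP.
  by move: (M0 i); rewrite negbK.
pose C : 'M[K]_n :=
  \matrix_i (if row i M == 0 then delta_mx 0 i0 else 0 : 'rV_n).
have CC : C *m C = 0.
  apply/row_matrixP => i; rewrite row_mul rowK row0.
  case: ifP => _; last by rewrite mul0mx.
  by rewrite -rowE rowK (negPf Mi0).
exists (1%:M + C).
  have /mulmx1_unit[] // : (1%:M + C) *m (1%:M - C) = 1%:M.
  by rewrite mulmxBr mulmx1 mulmxDl mul1mx CC addr0 addrK.
move=> i; rewrite mulmxDl mul1mx linearD /= row_mul rowK.
case: ifPn => [/eqP -> | Mi]; first by rewrite add0r -rowE.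
by rewrite mul0mx addr0.
Qed.

(** The columns of [R] are independent and no row of [Y] vanishes, so these n rank-one matrices are
    independent; [f] forms their combinations. *)
Lemma leq_dim_rank1 (K : fieldType) n p (N : {vspace 'M[K]_(n, p)})
    (R : 'M[K]_n) (Y : 'M[K]_(n, p)) :
    R \in unitmx -> (forall k, row k Y != 0) ->
    (forall k, col k R *m row k Y \in N) ->
  (n <= \dim N)%N.
Proof.
move=> Ru Y_neq0 RYN.
pose f : 'Hom('rV[K]_n, 'M[K]_(n, p)) :=
  linfun (mulmx R \o mulmxr Y \o @diag_mx K n).
have fE a : f a = R *m (diag_mx a *m Y) by rewrite lfunE.
have f_inj : lker f == 0%VS.
  apply/lker0P => a b; rewrite !fE => /(can_inj (mulKmx Ru)) abY.
  apply/rowP => k.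
  apply/eqP; rewrite -subr_eq0; apply: contraTT (Y_neq0 k) => ab_neq0.
  rewrite negbK; apply/eqP/rowP => l; move/matrixP: abY => /(_ k l).
  rewrite !mul_diag_mx !mxE => /eqP.
  by rewrite -subr_eq0 -mulrBl mulf_eq0 (negPf ab_neq0) => /eqP.
have dimf : \dim (limg f) = n.
  by rewrite limg_dim_eq ?dimvf /dim /= ?mul1n // (eqP f_inj) capv0.
apply: leq_trans (eq_leq (esym dimf)) (dimvS _).
apply/subvP => _ /memv_imgP[a _ ->].
rewrite fE (_ : R *m _ = \sum_k a 0 k *: (col k R *m row k Y)).
  by apply: memv_suml => k _; rewrite memvZ.
apply/matrixP => i j; rewrite !mxE summxE; apply: eq_bigr => k _.
by rewrite mul_diag_mx !mxE big_ord1 !mxE mulrCA.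
Qed.

(** * The induction on hyperplanes *)

Section AffineForms.
Variables (K : fieldType) (p : nat) (A : vectType K) (e : A).
Hypothesis e_neq0 : e != 0.

(** Dictionary: [c] is the linear form phi, matrices are tensors, [T] turns them into affine forms,
    [e] is the constant form 1 and [G c] is phi o F. *)
Lemma local_of_preim0 n (T : 'Hom('M[K]_(n, p), A)) (G : 'Hom('cV[K]_n, A)) :
    (T @^-1: <[e]> = 0)%VS ->
    (forall c : 'cV_n, (exists x : 'rV_p, T (c *m x) = e) \/
                       (exists x : 'rV_p, G c = T (c *m x))) ->
  exists x : 'rV_p, forall c, G c = T (c *m x).
Proof.
move=> N0 TG.
have T0 M : T M \in <[e]>%VS -> M = 0.
  by move=> TM; apply/eqP; rewrite -memv0 -N0 -memv_preim.
have T_inj : injective T.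
  move=> M M' TM; apply/eqP.
  by rewrite -subr_eq0 (T0 (M - M')) ?linearB /= ?TM ?subrr ?mem0v.
have G_loc c : exists x : 'rV_p, G c = T (c *m x).
  case: (TG c) => // -[x Tx]; case/negP: e_neq0.
  by rewrite -Tx (T0 (c *m x)) ?linear0 // Tx memv_line.
have [X GX] : exists X : 'M_(n, p),
    forall k, G (delta_mx k 0) = T (delta_mx k 0 *m row k X).
  have /fin_all_exists[x Gx] k := G_loc (delta_mx k 0).
  by exists (\matrix_k x k) => k; rewrite rowK.
have GE c : G c = T (diag_mx c^T *m X).
  rewrite {1}(matrix_sum_delta c) linear_sum /=.
  rewrite (_ : diag_mx _ *m _ = \sum_k c k 0 *: (delta_mx k 0 *m row k X)).
    rewrite linear_sum; apply: eq_bigr => k _.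
    by rewrite big_ord1 !linearZ /= GX.
  apply/matrixP => i j; rewrite mul_diag_mx summxE !mxE (bigD1 i) //= big1.
    by rewrite addr0 !mxE big_ord1 !mxE !eqxx mul1r.
  move=> k /negPf ki; rewrite !mxE big_ord1 !mxE eq_sym ki /=.
  by rewrite mul0r mulr0.
(* On the all-ones vector, injectivity of [T] forces all rows of [X] to be the same [x]. *)
have [x] := G_loc (const_mx 1); rewrite GE => /T_inj X1.
exists x => c; rewrite GE; congr (T _).
have {}X1 : X = const_mx 1 *m x.
  by rewrite -X1 trmx_const diag_const_mx mul1mx.
by apply/matrixP => i j; rewrite mul_diag_mx X1 !mxE !big_ord1 !mxE mul1r.
Qed.

(** The inclusion of the i-th coordinate hyperplane; [row' i] retracts onto it. *)
Definition hyperplane_mx n (i : 'I_n) : 'M[K]_(n, n.-1) := col' i 1%:M.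

Lemma row'_hyperplane_mx n (i : 'I_n) q (X : 'M_(n.-1, q)) :
  row' i (hyperplane_mx i *m X) = X.
Proof.
rewrite -[RHS]mul1mx (_ : 1%:M = row' i (hyperplane_mx i)).
  by apply/matrixP => k l; rewrite !mxE; apply: eq_bigr => j _; rewrite !mxE.
by apply/matrixP => k l; rewrite !mxE (inj_eq (@lift_inj _ _)).
Qed.

Lemma row_hyperplane_mx n (i : 'I_n) q (X : 'M_(n.-1, q)) :
  row i (hyperplane_mx i *m X) = 0.
Proof.
rewrite row_mul (_ : row i _ = 0) ?mul0mx //.
by apply/rowP => j; rewrite !mxE (negPf (neq_lift i j)).
Qed.

Lemma hyperplane_mx_row' n (i : 'I_n) q (X : 'M_(n, q)) :
  row i X = 0 -> hyperplane_mx i *m row' i X = X.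
Proof.
move=> Xi; apply/row_matrixP => k; case: (unliftP i k) => [j|] ->.
  have /row_matrixP/(_ j) := row'_hyperplane_mx i (row' i X).
  by rewrite !row_rowsub.
by rewrite row_hyperplane_mx Xi.
Qed.

Lemma local_of_dim_preim n (T : 'Hom('M[K]_(n, p), A)) (G : 'Hom('cV[K]_n, A)) :
    (\dim (T @^-1: <[e]>) + 2 <= n)%N ->
    (forall c : 'cV_n, (exists x : 'rV_p, T (c *m x) = e) \/
                       (exists x : 'rV_p, G c = T (c *m x))) ->
  exists x : 'rV_p, forall c, G c = T (c *m x).
Proof.
elim: n => [|n IHn] in T G *; first by rewrite addn2.
set N := (T @^-1: <[e]>)%VS => dimN TG.
have [N0|N_neq0] := eqVneq N 0%VS; first exact: local_of_preim0.
(* Since [N] is nonzero, the bound leaves only sizes at least 3, enough for three distinct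
   indices. *)
case: n => [|[|n]] in IHn T G @N dimN TG N_neq0 *.
- by move: dimN; rewrite addn2.
- by move: dimN; rewrite addn2 !ltnS leqn0 dimv_eq0 (negPf N_neq0).
have [|P Pu PM] := @exists_unit_rows_neq0 _ _ _ (vpick N).
  by rewrite vpick0.
have loc_i i : exists x : 'rV_p,
    forall c, row i (P *m c) = 0 -> G c = T (c *m x).
  pose Q : 'M_(n.+3, n.+2) := invmx P *m hyperplane_mx i.
  have PQ q (X : 'M_(_, q)) : P *m (Q *m X) = hyperplane_mx i *m X.
    by rewrite -mulmxA mulKVmx.
  pose fQ : 'Hom('M[K]_(n.+2, p), 'M[K]_(n.+3, p)) := linfun (mulmx Q).
  pose gQ : 'Hom('cV[K]_n.+2, 'cV[K]_n.+3) := linfun (mulmx Q).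
  have fQ_inj : lker fQ == 0%VS.
    apply/lker0P => X Y; rewrite !lfunE /= => XY.
    by rewrite -(row'_hyperplane_mx i X) -PQ XY PQ row'_hyperplane_mx.
  have [||x Gx] := IHn (T \o fQ)%VF (G \o gQ)%VF.
  - set N' := (_ @^-1: _)%VS.
    have NN' : (fQ @: N' <= N)%VS.
      apply/subvP => _ /memv_imgP[X XN' ->].
      by rewrite -memv_preim -comp_lfunE memv_preim.
    have : (\dim (fQ @: N') < \dim N)%N.
      (* Otherwise [vpick N] would come from the hyperplane, and row [i] of its product with [P]
         would vanish. *)
      rewrite ltn_neqAle dimvS // andbT; apply/negP => /eqP dimNN'.
      have /eqP NN : (fQ @: N')%VS == N by rewrite eqEdim NN' dimNN' leqnn.
      have := memv_pick N; rewrite -{2}NN => /memv_imgP[X _ vX].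
      by have := PM i; rewrite vX lfunE /= PQ row_hyperplane_mx eqxx.
    rewrite limg_dim_eq ?(eqP fQ_inj) ?capv0 // => ltN.
    by move: dimN; rewrite !addn2 !ltnS => /(leq_trans ltN).
  - move=> c; rewrite !comp_lfunE.
    have fg (x : 'rV_p) : (T \o fQ)%VF (c *m x) = T (gQ c *m x).
      by rewrite comp_lfunE !lfunE /= mulmxA.
    by case: (TG (gQ c)) => -[x Tx]; [left|right]; exists x; rewrite fg.
  exists x => c Pc.
  have cE : c = Q *m row' i (P *m c).
    by rewrite /Q -mulmxA hyperplane_mx_row' // mulKmx.
  have := Gx (row' i (P *m c)); rewrite !comp_lfunE !lfunE /=.
  by rewrite mulmxA -cE.
have [x Gx] := fin_all_exists loc_i.
have [/injectiveP x_inj|/injectivePn[i [j ij xij]]] := boolP (injectiveb x).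
  suff : (n.+3 <= \dim N)%N.
    by rewrite leqNgt -addn1 (leq_trans _ dimN) // leq_add2l.
  pose k1 (k : 'I_n.+3) := lift k ord0; pose k2 (k : 'I_n.+3) := lift k ord_max.
  apply: (@leq_dim_rank1 _ _ _ _ (invmx P) (\matrix_k (x (k1 k) - x (k2 k)))).
  - by rewrite unitmx_inv.
  - by move=> k; rewrite rowK subr_eq0; apply/eqP => /x_inj/lift_inj/eqP.
  - move=> k; rewrite rowK -memv_preim mulmxBr linearB /=.
    (* Column [k] of [invmx P] lies in every hyperplane but the k-th, so [x (k1 k)] and [x (k2 k)]
       both work for it. *)
    have Pk l : l != k -> row l (P *m col k (invmx P)) = 0.
      move=> /negPf lk; rewrite colE mulmxA mulmxV // mul1mx.
      by apply/rowP => z; rewrite !mxE lk.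
    by rewrite -!Gx ?subrr ?mem0v // Pk // eq_sym neq_lift.
exists (x i) => c.
(* The i-th component of [c]: [c - d] lies in hyperplane [i], and [d] in hyperplane [j]. *)
pose d := invmx P *m (delta_mx i 0 *m row i (P *m c)).
rewrite -(subrK d c) mulmxDl (linearD G) (linearD T); congr (_ + _).
  apply: Gx; rewrite mulmxBr linearB /= mulKVmx // (row_mul i (delta_mx i 0)).
  rewrite (_ : row i (delta_mx i 0) = 1%:M) ?mul1mx ?subrr //.
  by apply/matrixP => z z'; rewrite !ord1 !mxE !eqxx.
rewrite xij; apply: Gx; rewrite mulKVmx // (row_mul j (delta_mx i 0)).
rewrite (_ : row j _ = 0) ?mul0mx //.
by apply/rowP => z; rewrite !mxE eq_sym (negPf ij).
Qed.

End AffineForms.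

(** Neither [u] nor [g] vanishes on the kernel of [E], and over any field, even F_2, two proper
    subspaces do not cover a space. *)
Lemma exists_ker_sep (K : fieldType) p d (E : 'M[K]_(p, d)) (u g : 'rV[K]_d) :
    ~~ (u <= E)%MS -> ~~ (g <= E)%MS ->
  exists a : 'cV_d, [/\ E *m a = 0, (u *m a) 0 0 = 1 & (g *m a) 0 0 != 0].
Proof.
rewrite !submxE => /matrix0Pn[i0 [i]] + /matrix0Pn[j0 [j]].
rewrite !ord1 => ui gj.
have EC k : E *m col k (cokermx E) = 0.
  by rewrite colE mulmxA mulmx_coker mul0mx.
have colC (w : 'rV_d) k : (w *m col k (cokermx E)) 0 0 = (w *m cokermx E) 0 k.
  by rewrite colE mulmxA -colE mxE.
suff [b [Eb ub gb]] : exists b : 'cV_d,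
    [/\ E *m b = 0, (u *m b) 0 0 != 0 & (g *m b) 0 0 != 0].
  exists (((u *m b) 0 0)^-1 *: b); rewrite -!scalemxAr Eb scaler0.
  by split; rewrite // mxE ?mulVf // mulf_neq0 ?invr_eq0.
have [gi|gi] := eqVneq ((g *m cokermx E) 0 i) 0; last first.
  by exists (col i (cokermx E)); rewrite !colC.
have [uj|uj] := eqVneq ((u *m cokermx E) 0 j) 0; last first.
  by exists (col j (cokermx E)); rewrite !colC.
exists (col i (cokermx E) + col j (cokermx E)); rewrite !mulmxDr !EC addr0.
by split; rewrite // [X in X != 0]mxE !colC ?uj ?gi ?addr0 ?add0r.
Qed.

(** * Tensors as linear forms on L(U,V) *)

Section Pairing.
Variables (K : fieldType) (U V : vectType K).
Local Notation p := (dim U).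
Local Notation n := (dim V).

Lemma v2r_lfun (s : 'Hom(U, V)) x : v2r (s x) = v2r x *m f2mx s.
Proof. by rewrite unlock /= r2vK. Qed.

(* [M] is sent to the traces of its products with the matrices of the [g i], so
   that [c *m x] evaluates the linear form [c] at the vectors [g i (r2v x)]. *)
Definition pairing k (g : 'I_k -> 'Hom(U, V)) : 'Hom('M[K]_(n, p), 'rV[K]_k) :=
  linfun (mulmxr (\matrix_i mxvec (f2mx (g i))^T)^T \o mxvec).

Lemma pairing_rank1 k (g : 'I_k -> 'Hom(U, V)) c x i :
  pairing g (c *m x) 0 i = (v2r (g i (r2v x)) *m c) 0 0.
Proof.
rewrite lfunE /= v2r_lfun r2vK.
have := mxvec_dotmul (f2mx (g i))^T c^T x.
rewrite trmxK -!trmx_mul => /matrixP/(_ 0 0).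
rewrite [RHS]mxE mulmxA => <-; rewrite !mxE; apply: eq_bigr => l _.
by rewrite !mxE.
Qed.

Lemma eq_pairing k k' (g : 'I_k -> 'Hom(U, V)) (g' : 'I_k' -> 'Hom(U, V))
    M i j :
  g i = g' j -> pairing g M 0 i = pairing g' M 0 j.
Proof.
by move=> gij; rewrite !lfunE /= !mxE; apply: eq_bigr => l _; rewrite !mxE gij.
Qed.

(** Rank-nullity: pairing with a basis of [D] is onto, because rank-one tensors already detect any
    linear relation between the basis maps. *)
Lemma dim_lker_pairing (D : {vspace 'Hom(U, V)}) :
  (\dim (lker (pairing (tnth (vbasis D)))) + \dim D = n * p)%N.
Proof.
set g := tnth _; set T := (\matrix_i mxvec (f2mx (g i))^T)^T.
have Tfull : row_full T.
  rewrite /row_full -mxrank_tr -/(row_free _); apply: inj_row_free => r rT.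
  have r_dep : \sum_i r 0 i *: (vbasis D)`_i = 0.
    apply/lfunP => x; apply: (can_inj v2rK); rewrite zero_lfunE linear0.
    apply/rowP => j; have TrT : T *m r^T = 0.
      by rewrite -[T]trmxK -trmx_mul rT trmx0.
    have /rowP/(_ 0) : pairing g (delta_mx j 0 *m v2r x) *m r^T = 0.
      by rewrite lfunE /= -mulmxA TrT mulmx0.
    rewrite sum_lfunE linear_sum summxE !mxE => r0; rewrite -[RHS]r0.
    apply: eq_bigr => i _; rewrite pairing_rank1 v2rK -colE scale_lfunE linearZ.
    by rewrite !mxE mulrC /g (tnth_nth 0).
  by apply/rowP => i; rewrite mxE; apply: (freeP (basis_free (vbasisP D))).
have := limg_ker_dim (pairing g) fullv.
rewrite capfv dimvf /dim /= => <-; congr (_ + _)%N.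
have -> : limg (pairing g) = fullv.
  apply: subv_anti; rewrite subvf; apply/subvP => r _.
  have /submxP[w ->] := submx_full r Tfull.
  by apply/memv_imgP; exists (vec_mx w); rewrite ?memvf // lfunE /= vec_mxK.
by rewrite dimvf /dim /= mul1n.
Qed.

End Pairing.

(** * Homogeneous coordinates on [S] *)

Section AffineFrame.
Variables (K : fieldType) (U V : vectType K) (S : affspace 'Hom(U, V)).
Local Notation D := (aff_dir S).
Local Notation s0 := (aff_origin S).

(* The origin of [S] followed by a basis of its direction: the points of [S] are
   the combinations in which the origin has coefficient 1. *)
Definition frame (i : 'I_(\dim D).+1) : 'Hom(U, V) :=
  oapp (tnth (vbasis D)) s0 (unlift ord0 i).

(** [v] lists the value of [F] at the origin, then those of its linear part on the basis. *)
Lemma affine_map_frame (F : {s : 'Hom(U, V) | s \in S} -> V) :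
  affine_map F -> exists v : 'I_(\dim D).+1 -> V,
    forall (a : 'cV[K]_(\dim D).+1) s, a 0 0 = 1 ->
    val s = \sum_i a i 0 *: frame i -> F s = \sum_i a i 0 *: v i.
Proof.
case=> f Ff.
exists (fun i => oapp (fun i : 'I_(\dim D) => f (vsproj D (tnth (vbasis D) i)))
  (F (exist _ s0 (mem_aff_origin S))) (unlift ord0 i)).
move=> a s a0 sE; rewrite big_ord_recl unlift_none a0 scale1r /=.
apply/eqP; rewrite addrC -subr_eq Ff /= sE big_ord_recl /frame unlift_none a0.
rewrite scale1r addrC addKr !linear_sum; apply/eqP; apply: eq_bigr => i _.
by rewrite liftK /= !linearZ.
Qed.

Lemma frame_mem (a : 'cV[K]_(\dim D).+1) :
  a 0 0 = 1 -> \sum_i a i 0 *: frame i \in S.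
Proof.
move=> a0; rewrite unfold_in /= /mem_affspace big_ord_recl /frame unlift_none.
rewrite a0 scale1r addrC addKr; apply: memv_suml => i _.
by rewrite liftK /= memvZ // vbasis_mem // mem_tnth.
Qed.

Lemma frame_span s : s \in S ->
  exists2 a : 'cV[K]_(\dim D).+1, a 0 0 = 1 & s = \sum_i a i 0 *: frame i.
Proof.
rewrite unfold_in /= /mem_affspace => /coord_vbasis sE.
exists (\col_i oapp (fun i => coord (vbasis D) i (s - s0)) 1 (unlift ord0 i)).
  by rewrite mxE unlift_none.
rewrite -[LHS](subrK s0) big_ord_recl addrC /frame mxE unlift_none scale1r.
congr (_ + _); rewrite [LHS]sE; apply: eq_bigr => i _.
by rewrite mxE liftK /= (tnth_nth 0).
Qed.

(** [delta_mx 0 0] is the constant form 1: a tensor sent to a multiple of it pairs to zero with the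
    direction of [S], hence lies in a kernel of dimension codim S. *)
Lemma dim_preim_pairing_frame :
  (aff_codim S + 2 <= \dim {:V})%N ->
  (\dim (pairing frame @^-1: <[delta_mx 0%R 0%R]>) + 2 <= dim V)%N.
Proof.
rewrite (dimvf V); apply: leq_trans; rewrite leq_add2r /aff_codim /aff_dim.
rewrite dimvf /dim /= mulnC -(dim_lker_pairing D) addnK; apply: dimvS.
apply/subvP => M; rewrite -memv_preim memv_ker => /vlineP[t Mt].
apply/eqP/rowP => i.
rewrite (@eq_pairing _ _ _ _ _ _ frame _ _ (lift ord0 i)).
  by rewrite Mt !mxE mulr0.
by rewrite /frame liftK.
Qed.

End AffineFrame.

Arguments frame {K U V} S i.

(* The codimension bound is stated additively because a truncated
   \dim {:V} - 2 would be wrong when \dim {:V} < 2. *)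
Theorem theorem3p1 (K : fieldType) (U V : vectType K)
    (S : affspace 'Hom(U, V))
    (codimS : (aff_codim S + 2 <= \dim {:V})%N)
    (F : {s : 'Hom(U, V) | s \in S} -> V)
    (F_rc : range_compatible F) (F_affine : affine_map F) :
  local_map F.
Proof.
have [v Fv] := (affine_map_frame F_affine).
pose G : 'Hom('cV[K]_(dim V), 'rV[K]_(\dim (aff_dir S)).+1) :=
  linfun (trmx \o mulmx (\matrix_i v2r (v i))).
have GE c i : G c 0 i = (v2r (v i) *m c) 0 0.
  by rewrite lfunE !mxE; apply: eq_bigr => j _; rewrite mxE.
pose e0 : 'rV[K]_(\dim (aff_dir S)).+1 := delta_mx 0 0.
have e_neq0 : e0 != 0.
  by apply/eqP => /rowP/(_ 0)/eqP; rewrite !mxE !eqxx oner_eq0.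
have dimN := dim_preim_pairing_frame codimS.
have [c|x Gx] := local_of_dim_preim (G := G) e_neq0 dimN.
  pose E := \matrix_(j, i) (f2mx (frame S i) *m c) j 0.
  have TE x : pairing (frame S) (c *m x) = x *m E.
    apply/rowP => i; rewrite pairing_rank1 v2r_lfun r2vK -mulmxA !mxE.
    by apply: eq_bigr => j _; rewrite [E j i]mxE mxE.
  have [/submxP[x ex]|e_notin] := boolP (e0 <= E)%MS.
    by left; exists x; rewrite TE -ex.
  have [/submxP[x Gx]|G_notin] := boolP (G c <= E)%MS.
    by right; exists x; rewrite TE.
  (* If both alternatives fail, [a] gives a point s of [S] with phi o s = 0 but phi (F s) nonzero,
     although F s is in the image of s. *)
  have [a [Ea a0 Ga]] := exists_ker_sep e_notin G_notin.
  have {}a0 : a 0 0 = 1 by rewrite -a0 -rowE mxE.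
  case/negP: Ga; apply/eqP.
  pose s := exist (fun s => s \in S) _ (frame_mem a0).
  have sum_c (w : 'I_(\dim (aff_dir S)).+1 -> V) :
      (v2r (\sum_i a i 0 *: w i) *m c) 0 0 =
      \sum_i (v2r (w i) *m c) 0 0 * a i 0.
    rewrite linear_sum mulmx_suml summxE; apply: eq_bigr => i _.
    by rewrite linearZ -scalemxAl mxE mulrC.
  transitivity ((v2r (F s) *m c) 0 0).
    by rewrite (Fv a s a0 erefl) sum_c mxE; apply: eq_bigr => i _; rewrite GE.
  have /memv_imgP[y _ ->] := F_rc s.
  rewrite /= sum_lfunE; under eq_bigr do rewrite scale_lfunE.
  rewrite sum_c -[RHS](_ : (v2r y *m E *m a) 0 0 = 0); last first.
    by rewrite -mulmxA Ea mulmx0 mxE.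
  rewrite -TE mxE; apply: eq_bigr => i _.
  by rewrite pairing_rank1 v2rK.
exists (r2v x) => s.
have vE i : v i = frame S i (r2v x).
  apply: (can_inj v2rK); apply/rowP => j.
  have /rowP/(_ i) := Gx (delta_mx j 0).
  by rewrite GE pairing_rank1 -!colE !mxE.
have [a a0 sE] := frame_span (valP s).
rewrite (Fv a s a0 sE) sE sum_lfunE; apply: eq_bigr => i _.
by rewrite scale_lfunE vE.
Qed.
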